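(* Let $I=\langle \mathcal{N},\mathcal{R},L,\pi^0\rangle$ be an instance that is single-peaked with respect to an axis $\lhd$ and let $\pi^C$ be the allocation returned by the Crawler algorithm on $I$. Then $\pi^C$ is reachable by swap-deals from $\pi^0$, i.e. there is a (possibly empty) sequence of improving swap-deals leading from $\pi^0$ to $\pi^C$.
   Context: Housing market: an instance is $I=\langle \mathcal{N},\mathcal{R},L,\pi^0\rangle$ with $\mathcal{N}$ a set of $n$ agents, $\mathcal{R}$ a set of $n$ resources, $L$ a profile of strict linear orders $\succ_i$ over $\mathcal{R}$, one for each agent $a_i$, and $\pi^0$ an initial allocation; an allocation $\pi$ is a bijective assignment of one resource $\pi_{a_i}$ to each agent $a_i$. The instance is single-peaked with respect to an axis (linear order) $\lhd$ over $\mathcal{R}$ if for every agent $a_i$ with top resource $t_i$ and all resources $r,r'$, if $r'\lhd r\lhd t_i$ or $t_i\lhd r\lhd r'$ then $r\succ_i r'$. A swap-deal between two distinct agents exchanges the resources they currently hold; it is improving if both agents strictly prefer the resource they receive to the one they give away. Crawler algorithm (for an instance single-peaked with respect to $\lhd$): maintain the list $R$ of available resources ordered according to $\lhd$ (from left to right), and the list $N$ of available agents such that the $i$-th agent of $N$ is the current holder of the $i$-th resource of $R$; initially $R=\mathcal{R}$, $N=\mathcal{N}$ and holders are given by $\pi^0$. While $N\ne\emptyset$: find the first agent $a$ in the list $N$ (from left to right) whose most preferred resource in $R$, $top_R(a)$, is not strictly to the right (with respect to $\lhd$) of the resource she currently holds. Let $t$ be the position of $a$ and $t^*\le t$ the position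 of $top_R(a)$. Agent $a$ is definitively allocated $top_R(a)$; every agent in positions $t^*,\dots,t-1$ receives the resource held by the agent immediately on her right (so that the agent in position $j$ now holds the resource which was in position $j+1$); all other agents keep their resource; then $a$ and $top_R(a)$ are removed from $N$ and $R$. The algorithm ends when all resources have been allocated. *)

(* Defs.v *)
(* World: MathComp. *)
From HB Require Import structures.
From mathcomp Require Import all_boot fingroup perm zify.

Set Implicit Arguments.
Unset Strict Implicit.
Unset Printing Implicit Defensive.

Definition strict_linear_order (T : eqType) (lt : rel T) : Prop :=
  [/\ irreflexive lt, transitive lt & forall x y, x != y -> lt x y || lt y x].

(* [pref a r r'] reads "a strictly prefers r to r'".  The bijection [init]
   forces A and R to have the same number n of elements (possibly 0). *)
Record housing_market (A R : finType) := HousingMarket {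
  pref : A -> rel R;
  init : {ffun A -> R};
  pref_linear : forall a, strict_linear_order (pref a);
  init_bij : bijective init
}.

Definition is_top (T : eqType) (p : rel T) (s : seq T) (r : T) : bool :=
  (r \in s) && all (fun r' => (r' != r) ==> p r r') s.

(* The default value d is returned only if s has no p-greatest element; this
   does not happen when p is a strict linear order and s is nonempty. *)
Definition top (T : eqType) (p : rel T) (d : T) (s : seq T) : T :=
  nth d s (find (is_top p s) s).

Definition single_peaked (A R : finType) (I : housing_market A R)
    (axis : rel R) : Prop :=
  forall (a : A) (t : R), is_top (pref I a) (enum R) t ->
  forall r r' : R,
    (axis r' r /\ axis r t) \/ (axis t r /\ axis r r') -> pref I a r r'.

(* There is an improving swap-deal leading from pi to pi'. *)
Definition improving_swap (A R : finType) (I : housing_market A R) :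
    rel {ffun A -> R} :=
  fun pi pi' => [exists a, exists b,
    [&& a != b, pref I a (pi b) (pi a), pref I b (pi a) (pi b)
      & pi' == [ffun c => pi (tperm a b c)]]].

Definition swap_reachable (A R : finType) (I : housing_market A R)
    (pi pi' : {ffun A -> R}) : bool :=
  connect (improving_swap I) pi pi'.

(* [held] gives the current resource of available agents and the definitive
   one of agents that have left. *)
Record crawler_state (A R : finType) := CrawlerState {
  agents : seq A;
  resources : seq R;
  held : {ffun A -> R}
}.

Definition crawler_init (A R : finType) (I : housing_market A R)
    (axis : rel R) : crawler_state A R :=
  let rs := sort (fun r r' => (r == r') || axis r r') (enum R) in
  CrawlerState (pmap (fun r => [pick a | init I a == r]) rs) rs (init I).

(* Positions are counted from 0.  The state is unchanged only when no agent of
   the list satisfies the selection condition, in particular when the list is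
   empty. *)
Definition crawler_step (A R : finType) (I : housing_market A R)
    (axis : rel R) (s : crawler_state A R) : crawler_state A R :=
  let: CrawlerState N rs pi := s in
  let topR a := top (pref I a) (pi a) rs in
  let t := find (fun a => ~~ axis (pi a) (topR a)) N in
  if onth N t is Some a then
    let tstar := index (topR a) rs in
    CrawlerState (rem a N) (rem (topR a) rs)
      [ffun b => if b == a then topR a
                 else if tstar <= index b N < t
                      then pi (nth b N (index b N).+1)
                      else pi b]
  else s.

(* Each round removes one agent, so the loop "while N is nonempty" performs
   exactly #|A| rounds: see [crawler_terminates]. *)
Definition crawler_final (A R : finType) (I : housing_market A R)
    (axis : rel R) : crawler_state A R :=
  iter #|A| (crawler_step I axis) (crawler_init I axis).

Definition crawler (A R : finType) (I : housing_market A R)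
    (axis : rel R) : {ffun A -> R} :=
  held (crawler_final I axis).

(* The i-th available agent holds the i-th available resource, and the available
   resources are listed from left to right. *)
Definition crawler_inv (A R : finType) (axis : rel R)
    (s : crawler_state A R) : bool :=
  [&& uniq (agents s), sorted axis (resources s)
    & map (held s) (agents s) == resources s].

Lemma crawler_init_inv (A R : finType) (I : housing_market A R)
    (axis : rel R) : strict_linear_order axis ->
  crawler_inv axis (crawler_init I axis) /\
  size (agents (crawler_init I axis)) = #|A|.
Proof.
move=> [irr tr tot]; rewrite /crawler_inv /=.
set rs := sort _ _.
have Urs : uniq rs by rewrite sort_uniq enum_uniq.
have mrs r : r \in rs by rewrite mem_sort mem_enum.
have [g gK Kg] := init_bij I.
have -> : pmap (fun r => [pick a | init I a == r]) rs = map g rs.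
  elim: (rs) => //= r s ->; case: pickP => [a /eqP <-|/(_ (g r))].
    by rewrite gK.
  by rewrite Kg eqxx.
rewrite (map_inj_uniq (can_inj Kg)) Urs -map_comp map_id_in; last first.
  by move=> r _ /=; rewrite Kg.
rewrite eqxx andbT size_map size_sort -cardE; split; last first.
  by apply/esym/(bij_eq_card (init_bij I)).
have : sorted (fun r r' => (r == r') || axis r r') rs.
  apply: sort_sorted => r r' /=.
  by case: eqVneq => //= ne; rewrite tot.
move: Urs; case: (rs) => //= r s.
elim: s r => //= r' s IHs r; rewrite inE negb_or -andbA.
by case/and3P=> /negPf -> _ U /= /andP[-> P]; apply: IHs.
Qed.

Lemma mem_top (T : eqType) (p : rel T) (d : T) (s : seq T) :
  d \in s -> top p d s \in s.
Proof.
move=> ds; rewrite /top; case: (ltnP (find (is_top p s) s) (size s)) => h.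
  exact: mem_nth.
by rewrite nth_default.
Qed.

Lemma nth_rem (T : eqType) (d x : T) (s : seq T) (i : nat) :
  nth d (rem x s) i = nth d s (bump (index x s) i).
Proof.
elim: s i => [|y s IHs] i /=; first by rewrite !nth_nil.
rewrite eq_sym; case: eqVneq => //= _.
by case: i => [|i] //=; rewrite IHs bumpS.
Qed.

Lemma crawler_step_inv (A R : finType) (I : housing_market A R)
    (axis : rel R) (s : crawler_state A R) : strict_linear_order axis ->
  crawler_inv axis s ->
  crawler_inv axis (crawler_step I axis s) /\
  size (agents (crawler_step I axis s)) = (size (agents s)).-1.
Proof.
move=> [irr tr tot]; case: s => N rs pi.
rewrite /crawler_inv => /= /and3P[UN Srs /eqP Ers].
set topR := fun a => top (pref I a) (pi a) rs.
set t := find _ N.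
have topM a : a \in N -> topR a \in rs.
  by move=> aN; apply: mem_top; rewrite -Ers map_f.
have Urs : uniq rs by apply: sorted_uniq Srs.
have szN : size N = size rs by rewrite -Ers size_map.
have hasN : N <> [::] -> has (fun a => ~~ axis (pi a) (topR a)) N.
  clear t UN szN; move: topM Ers; case/lastP: N => // N' a topM Ers _.
  rewrite has_rcons; apply/orP; left; apply/negP => lt.
  have := topM a; rewrite mem_rcons mem_head => /(_ isT).
  set x := topR a in lt *; rewrite -Ers map_rcons.
  move: Srs; rewrite -Ers map_rcons sorted_pairwise // pairwise_rcons.
  case/andP=> /allP al _; rewrite mem_rcons inE => /orP[/eqP E|/al lt'].
    by rewrite E irr in lt.
  by have := tr _ _ _ lt lt'; rewrite irr.
have [N0|/eqP/hasN] := eqVneq N [::].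
  by rewrite /t N0 in Ers *; rewrite /= Srs -Ers.
rewrite has_find -/t => tN.
have [a0 _] : exists a0, a0 \in N.
  by case: (N) tN => // a0 ?; exists a0; rewrite mem_head.
have aN : nth a0 N t \in N by apply: mem_nth.
have Pa : ~~ axis (pi (nth a0 N t)) (topR (nth a0 N t)).
  by apply: (nth_find a0 (a := fun a => ~~ axis (pi a) (topR a))); rewrite has_find.
have ia : index (nth a0 N t) N = t by rewrite index_uniq.
have -> : onth N t = Some (nth a0 N t) by rewrite onthE (nth_map a0).
move: ia aN Pa; set a := nth _ _ _ => ia aN Pa.
have xrs := topM _ aN; set x := topR a in xrs Pa *.
have lets : index x rs <= t.
  rewrite leqNgt; apply: contra Pa => lt.
  have -> : pi a = nth x rs t by rewrite -Ers (nth_map a0).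
  have {2}<- : nth x rs (index x rs) = x by rewrite nth_index.
  apply: (sorted_ltn_nth tr x Srs) => //; rewrite inE -?szN //.
  by rewrite szN index_mem.
rewrite /= size_rem // rem_uniq //=; split=> //.
rewrite (subseq_sorted tr (rem_subseq _ _)) //=.
apply/eqP/(@eq_from_nth _ x); first by rewrite size_map !size_rem // szN.
rewrite size_map size_rem // => i ltiN.
rewrite (nth_map a0) ?size_rem // !nth_rem ia ffunE.
have bN : bump t i < size N.
  by move: ltiN tN; rewrite /bump; case: (leqP t i) => /= ?; lia.
rewrite index_uniq //.
have -> : (nth a0 N (bump t i) == a) = false.
  by rewrite /a nth_uniq // eq_sym; apply/negbTE/neq_bump.
case: ifP => h.
  have lt : (bump t i).+1 < size N by case/andP: h => _ /leq_ltn_trans; apply.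
  rewrite (set_nth_default a0) // -(nth_map a0 x) // Ers.
  congr nth; move: h; rewrite /bump.
  by case: (leqP t i) => /= ?; case: (leqP (index x rs) i) => /= ?; lia.
rewrite -(nth_map a0 x) // Ers.
congr nth; move: h; rewrite /bump.
by case: (leqP t i) => /= ?; case: (leqP (index x rs) i) => /= ?; lia.
Qed.

Lemma crawler_terminates (A R : finType) (I : housing_market A R)
    (axis : rel R) :
  strict_linear_order axis -> agents (crawler_final I axis) = [::].
Proof.
move=> lin; have [inv0 sz0] := crawler_init_inv I lin.
suff H k : let s := iter k (crawler_step I axis) (crawler_init I axis) in
    crawler_inv axis s /\ size (agents s) = #|A| - k.
  by apply: size0nil; rewrite (H _).2 subnn.
elim: k => [|k [inv sz]] /=; first by rewrite subn0.
have [inv' sz'] := crawler_step_inv I lin inv.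
by rewrite sz' sz subnS.
Qed.

Lemma top_correct (T : eqType) (p : rel T) (d : T) (s : seq T) :
  strict_linear_order p -> s <> [::] -> is_top p s (top p d s).
Proof.
move=> [irr tr tot] s0; apply: nth_find; apply/hasP.
suff [m m_top] : exists m, is_top p s m by exists m => //; case/andP: m_top.
elim: s s0 => // x [|y s] IHs _.
  by exists x; rewrite /is_top /= inE eqxx.
have [//|m /andP[ms /allP mt]] := IHs.
have [pxm|npxm] := boolP (p x m).
  exists x; rewrite /is_top mem_head; apply/allP => r'.
  rewrite inE => /predU1P[->|r's]; first by rewrite eqxx.
  apply/implyP => _; have := mt _ r's.
  by case: eqVneq => [->|_ /= pmr] //; apply: tr pmr.
exists m; rewrite /is_top inE ms orbT; apply/allP => r'.
rewrite inE => /predU1P[->|/mt //]; apply/implyP => ne.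
by have := tot _ _ ne; rewrite (negPf npxm).
Qed.

(* Main.v *)
(* A single crawler round is itself a sequence of improving swap-deals: the
   selected agent, at position t, trades with her left neighbours at positions
   t-1, ..., t* in turn. Preferences restricted to the available resources
   remain single-peaked, so she gains by moving towards her top, and each
   neighbour gains because, not having been selected, her top lies strictly to
   her right. *)
Require Import Defs.
From mathcomp Require Import all_boot fingroup perm zify.

Set Implicit Arguments.
Unset Strict Implicit.
Unset Printing Implicit Defensive.

Lemma single_peaked_sub (A R : finType) (I : housing_market A R)
    (axis : rel R) (s : seq R) (a : A) (x r r' : R) :
  strict_linear_order axis -> single_peaked I axis ->
  is_top (pref I a) s x -> r \in s -> r' \in s ->
  (axis r' r /\ (r == x) || axis r x) \/ (axis r r' /\ (r == x) || axis x r) ->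
  pref I a r r'.
Proof.
move=> [irr tr tot] sp /andP[xs /allP xtop] rs r's dir.
have rr' : r' != r.
  by apply/eqP => E; case: dir => -[]; rewrite E irr.
have [rx|rx] := eqVneq r x.
  by rewrite rx in rr' *; move/(_ _ r's)/implyP: xtop; apply.
have [pirr ptr _] := pref_linear I a.
have xr : pref I a x r by move/(_ _ rs)/implyP: xtop; apply.
have [p ptop] : exists p, is_top (pref I a) (enum R) p.
  exists (top (pref I a) x (enum R)); apply: top_correct (pref_linear I a) _.
  by move=> E; have := mem_enum R x; rewrite E.
have [pr|pr] := eqVneq p r.
  case/andP: ptop => _ /allP/(_ r'); rewrite mem_enum pr => /(_ isT)/implyP.
  by apply.
have not_rx : ~ pref I a r x.
  by move=> rx'; have := ptr _ _ _ rx' xr; rewrite pirr.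
case: dir => -[r'r]; rewrite (negPf rx) /= => rlx.
- have /orP[lt|lt] := tot _ _ pr; last by apply: (sp a p ptop); left.
  by case: not_rx; apply: (sp a p ptop); right.
- have /orP[lt|lt] := tot _ _ pr; first by apply: (sp a p ptop); right.
  by case: not_rx; apply: (sp a p ptop); left.
Qed.

Lemma shift_reachable (A R : finType) (I : housing_market A R) (N : seq A)
    (pi : {ffun A -> R}) (a : A) (m t : nat) :
  uniq N -> t < size N -> nth a N t = a -> m <= t ->
  (forall j, m <= j < t ->
     pref I a (pi (nth a N j)) (pi (nth a N j.+1)) /\
     pref I (nth a N j) (pi (nth a N j.+1)) (pi (nth a N j))) ->
  swap_reachable I pi
    [ffun b => if b == a then pi (nth a N m)
               else if m <= index b N < t then pi (nth b N (index b N).+1)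
               else pi b].
Proof.
move=> UN tN at_; elim/ltn_ind: {m}(t - m) {-2}m (erefl (t - m)) => k IHk m km.
rewrite leq_eqVlt => /predU1P[-> _|mt better].
  rewrite (_ : finfun _ = pi); first exact: connect0.
  apply/ffunP => b; rewrite ffunE at_; case: eqP => [-> //|_].
  by case: ifP => //; lia.
apply: connect_trans (IHk (t - m.+1) _ m.+1 erefl mt _) _; first lia.
  by move=> j jt; apply: better; lia.
apply: connect1; set b := nth a N m.
have mN : m < size N by lia.
have ib : index b N = m by rewrite index_uniq.
have ba : b != a by rewrite -at_ nth_uniq //; lia.
have [] := better m; first lia.
rewrite -/b => pa pb.
apply/existsP; exists a; apply/existsP; exists b.
rewrite !ffunE eqxx (negPf ba) ib ltnn /= eq_sym ba pa pb /=.
apply/eqP/ffunP => c; rewrite !ffunE.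
have [->|ca] := eqVneq c a; first by rewrite tpermL (negPf ba) ib ltnn.
have [->|cb] := eqVneq c b.
  by rewrite tpermR eqxx ib leqnn mt /= (set_nth_default a) //; lia.
rewrite tpermD 1?eq_sym // [a == c]eq_sym (negPf ca).
congr (if _ && _ then _ else _).
rewrite leq_eqVlt; case: eqP => //= mc.
have cN : c \in N by rewrite -index_mem -mc.
by case/eqP: cb; rewrite /b mc nth_index.
Qed.

Lemma crawler_step_reachable (A R : finType) (I : housing_market A R)
    (axis : rel R) (s : crawler_state A R) :
  strict_linear_order axis -> single_peaked I axis -> crawler_inv axis s ->
  swap_reachable I (held s) (held (crawler_step I axis s)).
Proof.
move=> lin sp; have [irr tr tot] := lin; case: s => N rs pi.
rewrite /crawler_inv => /= /and3P[UN Srs /eqP Ers].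
set topR := fun a => top (pref I a) (pi a) rs.
set t := find _ N.
have [tN|Nt] := ltnP t (size N); last first.
  by rewrite onthE nth_default ?size_map //; apply: connect0.
have [a0 _] : exists a0, a0 \in N.
  by case: (N) tN => // a0 ?; exists a0; rewrite mem_head.
have Pa : ~~ axis (pi (nth a0 N t)) (topR (nth a0 N t)).
  apply: (nth_find a0 (a := fun a => ~~ axis (pi a) (topR a))).
  by rewrite has_find.
have -> : onth N t = Some (nth a0 N t) by rewrite onthE (nth_map a0).
move: (set_nth_default (nth a0 N t) a0 tN) Pa.
set a := nth a0 N t; clearbody a => {a0} /esym at_ Pa /=.
have szN : size rs = size N by rewrite -Ers size_map.
have rs0 : rs <> [::] by move=> E; rewrite -szN E in tN.
have topP b : is_top (pref I b) rs (topR b).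
  exact: top_correct (pref_linear I b) rs0.
have nthE j : j < size N -> pi (nth a N j) = nth (pi a) rs j.
  by move=> jN; rewrite -Ers (nth_map a).
have lt_nth i j : i < j -> j < size N -> axis (pi (nth a N i)) (pi (nth a N j)).
  move=> ij jN; rewrite !nthE //; last by lia.
  by apply: (sorted_ltn_nth tr (pi a) Srs) => //; rewrite inE szN; lia.
have mem_pi j : j < size N -> pi (nth a N j) \in rs.
  by move=> jN; rewrite -Ers map_f // mem_nth.
set x := topR a; set m := index x rs.
have xrs : x \in rs by case/andP: (topP a).
have mN : m < size N by rewrite -szN index_mem.
have xE : x = pi (nth a N m) by rewrite nthE // nth_index.
have mt : m <= t.
  rewrite leqNgt; apply: contra Pa => lt.
  by rewrite -/x xE -{1}at_; apply: lt_nth.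
rewrite -/(topR a) -/x xE; apply: shift_reachable => // j /andP[mj jt].
have jN : j.+1 < size N by lia.
have step := lt_nth j j.+1 (ltnSn j) jN.
split.
  apply: (single_peaked_sub lin sp (topP a)); rewrite ?mem_pi //; try lia.
  right; split=> //; rewrite -/x xE; move: mj; rewrite leq_eqVlt.
  by case/predU1P=> [->|mj]; rewrite ?eqxx // lt_nth ?orbT //; lia.
set b := nth a N j.
apply: (single_peaked_sub lin sp (topP b)); rewrite ?mem_pi //; try lia.
left; split=> //.
have : axis (pi b) (topR b) by apply/negPn/negbT/(before_find a jt).
have trs : topR b \in rs by case/andP: (topP b).
have iN : index (topR b) rs < size N by rewrite -szN index_mem.
have -> : topR b = pi (nth a N (index (topR b) rs)) by rewrite nthE // nth_index.
move: (index _ _) iN => i iN lt.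
have [ij|ji|->] := ltngtP i j.+1; last by rewrite eqxx.
  have := ij; rewrite ltnS leq_eqVlt => /predU1P[E|ij'].
    by rewrite E irr in lt.
  have jN' : j < size N by lia.
  by have := tr _ _ _ lt (lt_nth _ _ ij' jN'); rewrite irr.
by rewrite lt_nth ?orbT.
Qed.

Theorem proposition6 (A R : finType) (I : housing_market A R) (axis : rel R)
  (axis_linear : strict_linear_order axis)
  (I_single_peaked : single_peaked I axis) :
  swap_reachable I (init I) (crawler I axis).
Proof.
rewrite /crawler /crawler_final.
set s0 := crawler_init I axis.
suff H k : crawler_inv axis (iter k (crawler_step I axis) s0) /\
    swap_reachable I (init I) (held (iter k (crawler_step I axis) s0)).
  by case: (H #|A|).
elim: k => [|k [inv reach]] /=.
  by split; [case: (crawler_init_inv I axis_linear) | apply: connect0].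
split; first by case: (crawler_step_inv I axis_linear inv).
by apply: connect_trans reach _; apply: crawler_step_reachable.
Qed.
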